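(* Let $(\bar x,\bar y)\in\mathbb{R}^n\times\mathbb{R}^m$ be a local optimal solution of $$\min_{x,y} F(x,y)\quad\text{s.t.}\quad G(x,y)\le 0,\; g(x,y)\le 0,\; f(x,y)\le\varphi(x),\qquad (\mathrm{VF})$$ and assume that (VF) is partially calm at $(\bar x,\bar y)$. Assume that $f$ and $g_1,\dots,g_q$ are fully convex (convex in $(x,y)$ jointly). Suppose further that the lower-level Mangasarian–Fromovitz constraint qualification (LMFCQ) holds at $\bar x$ and that the upper-level Mangasarian–Fromovitz constraint qualification (UMFCQ) holds at $(\bar x,\bar y)$. Then there exist $\lambda\in(0,\infty)$, $u\in\mathbb{R}^p$, $v,w\in\mathbb{R}^q$ and $z\in\mathbb{R}^m$ such that, with $(x,y)=(\bar x,\bar y)$, $$\nabla_1F(x,y)+\sum_{i=1}^p u_i\nabla_1G_i(x,y)+\sum_{j=1}^q v_j\nabla_1 g_j(x,y)+\lambda\nabla_1 f(x,y)-\lambda\nabla_1\ell(x,z,w)=0,$$ $$\nabla_2F(x,y)+\sum_{i=1}^p u_i\nabla_2G_i(x,y)+\sum_{j=1}^q v_j\nabla_2 g_j(x,y)+\lambda\nabla_2 f(x,y)=0,$$ $$\nabla_2 f(x,z)+\sum_{j=1}^q w_j\nabla_2 g_j(x,z)=0,$$ $$u\ge 0,\; G(x,y)\le 0,\; u^\top G(x,y)=0,$$ $$v\ge 0,\; g(x,y)\le 0,\; v^\top g(x,y)=0,$$ $$w\ge 0,\; g(x,z)\le 0,\; w^\top g(x,z)=0.$$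
   Context: The functions $F,f:\mathbb{R}^n\times\mathbb{R}^m\to\mathbb{R}$, $G:\mathbb{R}^n\times\mathbb{R}^m\to\mathbb{R}^p$ and $g:\mathbb{R}^n\times\mathbb{R}^m\to\mathbb{R}^q$ are twice continuously differentiable. Vector inequalities are componentwise. $S(x):=\operatorname{argmin}_z\{f(x,z)\mid g(x,z)\le 0\}$ is assumed nonempty for every $x\in\mathbb{R}^n$, and $\varphi(x):=\min_z\{f(x,z)\mid g(x,z)\le 0\}$, so $\varphi:\mathbb{R}^n\to\mathbb{R}$ is finite-valued. $\nabla_1,\nabla_2$ denote gradients with respect to the first (upper-level, in $\mathbb{R}^n$) and second (lower-level, in $\mathbb{R}^m$) variable, and $\nabla$ the gradient with respect to both. $\ell(x,z,w):=f(x,z)+w^\top g(x,z)$. Partial calmness: (VF) is partially calm at a feasible point $(\bar x,\bar y)$ if there exist $\lambda\in(0,\infty)$ and a neighborhood $U$ of $(\bar x,\bar y,0)\in\mathbb{R}^n\times\mathbb{R}^m\times\mathbb{R}$ such that $F(x,y)-F(\bar x,\bar y)+\lambda|\varsigma|\ge 0$ for all $(x,y,\varsigma)\in U$ with $G(x,y)\le0$, $g(x,y)\le 0$, $f(x,y)-\varphi(x)+\varsigma=0$. UMFCQ at $(\bar x,\bar y)$: there is $d\in\mathbb{R}^{n+m}$ with $\nabla G_i(\bar x,\bar y)^\top d<0$ for all $i$ with $G_i(\bar x,\bar y)=0$ and $\nabla g_j(\bar x,\bar y)^\top d<0$ for all $j$ with $g_j(\bar x,\bar y)=0$. LMFCQ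 at $\bar x$: for every $z\in S(\bar x)$ there is $d\in\mathbb{R}^m$ with $\nabla_2 g_j(\bar x,z)^\top d<0$ for all $j$ with $g_j(\bar x,z)=0$. *)

(* Defs.v *)
From mathcomp Require Import all_boot all_order all_algebra.
From mathcomp Require Import all_classical all_reals all_analysis.

Set Implicit Arguments.
Unset Strict Implicit.
Unset Printing Implicit Defensive.

Import Order.TTheory GRing.Theory Num.Theory.
Import numFieldNormedType.Exports.

Local Open Scope classical_set_scope.
Local Open Scope ring_scope.

Definition vle (R : realType) (k : nat) (a b : 'rV[R]_k) : Prop :=
  forall i, a 0 i <= b 0 i.

Definition dot (R : realType) (k : nat) (a b : 'rV[R]_k) : R :=
  \sum_(i < k) a 0 i * b 0 i.

Definition component (R : realType) (T : Type) (k : nat) (h : T -> 'rV[R]_k)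
  (i : 'I_k) : T -> R := fun e => h e 0 i.

(** Continuity of the derivative is expressed direction by direction; on the
    finite-dimensional spaces used here this is continuity of the full
    (first, resp. second) derivative. *)
Definition C1 (R : realType) (V W : normedModType R) (h : V -> W) : Prop :=
  (forall e, differentiable h e) /\ (forall v, continuous ('D_v h)).

Definition C2 (R : realType) (V W : normedModType R) (h : V -> W) : Prop :=
  (forall e, differentiable h e) /\ (forall v, C1 ('D_v h)).

Definition grad1 (R : realType) (n m : nat) (h : 'rV[R]_n * 'rV[R]_m -> R)
  (e : 'rV[R]_n * 'rV[R]_m) : 'rV[R]_n :=
  \row_(i < n) 'D_((delta_mx 0 i : 'rV[R]_n), (0 : 'rV[R]_m)) h e.

Definition grad2 (R : realType) (n m : nat) (h : 'rV[R]_n * 'rV[R]_m -> R)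
  (e : 'rV[R]_n * 'rV[R]_m) : 'rV[R]_m :=
  \row_(i < m) 'D_((0 : 'rV[R]_n), (delta_mx 0 i : 'rV[R]_m)) h e.

Definition grad (R : realType) (n m : nat) (h : 'rV[R]_n * 'rV[R]_m -> R)
  (e : 'rV[R]_n * 'rV[R]_m) : 'rV[R]_(n + m) :=
  row_mx (grad1 h e) (grad2 h e).

Definition fully_convex (R : realType) (n m : nat)
  (h : 'rV[R]_n * 'rV[R]_m -> R) : Prop :=
  convex_function [set: 'rV[R]_n * 'rV[R]_m] h.

Definition lower_feasible (R : realType) (n m q : nat)
  (g : 'rV[R]_n * 'rV[R]_m -> 'rV[R]_q) (x : 'rV[R]_n) : set 'rV[R]_m :=
  [set z | vle (g (x, z)) 0].

Definition lower_sol (R : realType) (n m q : nat)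
  (f : 'rV[R]_n * 'rV[R]_m -> R) (g : 'rV[R]_n * 'rV[R]_m -> 'rV[R]_q)
  (x : 'rV[R]_n) : set 'rV[R]_m :=
  [set z | lower_feasible g x z /\
           forall z', lower_feasible g x z' -> f (x, z) <= f (x, z')].

(** The infimum is the minimum whenever [lower_sol f g x] is nonempty; [inf] of
    a set that is empty or not bounded below is a junk value. *)
Definition lower_value (R : realType) (n m q : nat)
  (f : 'rV[R]_n * 'rV[R]_m -> R) (g : 'rV[R]_n * 'rV[R]_m -> 'rV[R]_q)
  (x : 'rV[R]_n) : R :=
  inf [set f (x, z) | z in lower_feasible g x].

Definition lagrangian (R : realType) (n m q : nat)
  (f : 'rV[R]_n * 'rV[R]_m -> R) (g : 'rV[R]_n * 'rV[R]_m -> 'rV[R]_q)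
  (w : 'rV[R]_q) : 'rV[R]_n * 'rV[R]_m -> R :=
  fun e => f e + dot w (g e).

Definition VF_feasible (R : realType) (n m p q : nat)
  (f : 'rV[R]_n * 'rV[R]_m -> R) (G : 'rV[R]_n * 'rV[R]_m -> 'rV[R]_p)
  (g : 'rV[R]_n * 'rV[R]_m -> 'rV[R]_q) : set ('rV[R]_n * 'rV[R]_m) :=
  [set e | [/\ vle (G e) 0, vle (g e) 0 & f e <= lower_value f g e.1]].

Definition VF_local_solution (R : realType) (n m p q : nat)
  (F f : 'rV[R]_n * 'rV[R]_m -> R) (G : 'rV[R]_n * 'rV[R]_m -> 'rV[R]_p)
  (g : 'rV[R]_n * 'rV[R]_m -> 'rV[R]_q) (e0 : 'rV[R]_n * 'rV[R]_m) : Prop :=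
  VF_feasible f G g e0 /\
  \forall e \near e0, VF_feasible f G g e -> F e0 <= F e.

Definition VF_partially_calm (R : realType) (n m p q : nat)
  (F f : 'rV[R]_n * 'rV[R]_m -> R) (G : 'rV[R]_n * 'rV[R]_m -> 'rV[R]_p)
  (g : 'rV[R]_n * 'rV[R]_m -> 'rV[R]_q) (e0 : 'rV[R]_n * 'rV[R]_m) : Prop :=
  exists2 lambda : R, 0 < lambda &
  exists2 U : set (('rV[R]_n * 'rV[R]_m) * R), nbhs (e0, 0 : R) U &
    forall (e : 'rV[R]_n * 'rV[R]_m) (s : R), U (e, s) ->
      vle (G e) 0 -> vle (g e) 0 -> f e - lower_value f g e.1 + s = 0 ->
      0 <= F e - F e0 + lambda * `|s|.

Definition UMFCQ (R : realType) (n m p q : nat)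
  (G : 'rV[R]_n * 'rV[R]_m -> 'rV[R]_p)
  (g : 'rV[R]_n * 'rV[R]_m -> 'rV[R]_q) (e : 'rV[R]_n * 'rV[R]_m) : Prop :=
  exists d : 'rV[R]_(n + m),
    (forall i, G e 0 i = 0 -> dot (grad (component G i) e) d < 0) /\
    (forall j, g e 0 j = 0 -> dot (grad (component g j) e) d < 0).

Definition LMFCQ (R : realType) (n m q : nat)
  (f : 'rV[R]_n * 'rV[R]_m -> R) (g : 'rV[R]_n * 'rV[R]_m -> 'rV[R]_q)
  (x : 'rV[R]_n) : Prop :=
  forall z, lower_sol f g x z ->
    exists d : 'rV[R]_m,
      forall j, g (x, z) 0 j = 0 -> dot (grad2 (component g j) (x, z)) d < 0.

(* Main.v *)
(** The lower-level point [z] can be taken to be [y] itself. Feasibility makes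
    [y] a solution of the lower-level problem at [x]; LMFCQ gives it a KKT
    multiplier [w], and full convexity turns the lower-level Lagrangian into an
    affine minorant: [xi = grad1 (lagrangian f g w) (x, y)] is a subgradient of
    the value function at [x]. Replacing the value function by this minorant in
    the partially calm penalized problem, [(x, y)] is a local minimizer of the
    smooth function [F + lambda * (f - xi . x)] subject to [G <= 0], [g <= 0]
    only, and the KKT theorem under UMFCQ gives [u] and [v]. No directional
    derivative of the value function is needed, as one subgradient suffices. *)

Require Import Defs.
From mathcomp Require Import all_boot all_order all_algebra.
From mathcomp Require Import all_classical all_reals all_analysis.
From mathcomp Require Import ring lra.

Set Implicit Arguments.
Unset Strict Implicit.
Unset Printing Implicit Defensive.

Import Order.TTheory GRing.Theory Num.Theory.
Import numFieldNormedType.Exports.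

Local Open Scope classical_set_scope.
Local Open Scope ring_scope.

(** * Farkas' lemma for finitely many linear functionals *)

Lemma farkas (R : realFieldType) (V : lmodType R) (k : nat)
    (a : 'I_k -> V -> R) (b : V -> R) :
    (forall i, scalar (a i)) -> scalar b ->
    (forall d, (forall i, a i d <= 0) -> b d <= 0) ->
  exists2 mu : 'I_k -> R, (forall i, 0 <= mu i) &
    forall d, b d = \sum_i mu i * a i d.
Proof.
elim: k a b => [|k IH] a b a_lin b_lin Hab.
  exists (fun=> 0) => // d; rewrite big_ord0.
  have ge d' : b d' <= 0 by apply: Hab => -[].
  apply/eqP; rewrite eq_le ge /=.
  have := ge (-1 *: d + 0); rewrite b_lin.
  have := b_lin 1 0 0; rewrite scaler0 addr0; lra.
pose a' i := a (lift ord_max i); pose ak := a ord_max.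
have [Hab'|] := pselect (forall d, (forall i, a' i d <= 0) -> b d <= 0).
  have [//|mu mu0 bE] := IH a' b (fun i => a_lin _) b_lin.
  exists (fun i => oapp mu 0 (unlift ord_max i)).
    by move=> i; case: unliftP => /=.
  move=> d; rewrite (bigD1_ord ord_max) //= unlift_none /= mul0r add0r bE.
  by apply: eq_bigr => i _; rewrite liftK.
move=> /existsNP[d0 /not_implyP[a'd0 /negP]]; rewrite -ltNge => bd0.
(* [d0] satisfies all the other inequalities and still has [0 < b d0], so it must violate the last
   one. *)
have akd0 : 0 < ak d0.
  rewrite ltNge; apply/negP => akd0; move: bd0; rewrite ltNge Hab // => i.
  by case: (unliftP ord_max i) => [j|] ->; [exact: a'd0|].
(* [P] projects along [d0] onto the kernel of the last functional. *)
pose P d := (- (ak d / ak d0)) *: d0 + d.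
have PE (c : V -> R) : scalar c ->
    forall d, c (P d) = c d - ak d * (c d0 / ak d0).
  by move=> cl d; rewrite /P cl; field; rewrite gt_eqF.
have P_lin (c : V -> R) : scalar c -> scalar (c \o P).
  move=> cl s u v /=; rewrite !PE // /ak a_lin cl; ring.
have [||d Hd|mu mu0 bE] := IH (fun i => a' i \o P) (b \o P).
- by move=> i; apply: P_lin; apply: a_lin.
- exact: P_lin.
(* The last functional vanishes on [P d], so the full premise holds there. *)
- apply: Hab => i; case: (unliftP ord_max i) => [j|] ->; first exact: Hd.
  rewrite PE // /ak -/ak mulfV ?gt_eqF // mulr1; lra.
(* The value forced by the identity at [d0]; it is nonnegative because [0 < b d0], [a' i d0 <= 0]
   and [0 < ak d0]. *)
pose nu := (b d0 - \sum_i mu i * a' i d0) / ak d0.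
exists (fun i => oapp mu nu (unlift ord_max i)).
  move=> i; case: unliftP => //= _.
  apply: divr_ge0; last exact: ltW.
  rewrite subr_ge0.
  apply: (le_trans _ (ltW bd0)); rewrite -oppr_ge0 -sumrN.
  by apply: sumr_ge0 => j _; rewrite -mulrN mulr_ge0 // oppr_ge0.
move=> d; rewrite (bigD1_ord ord_max) //= unlift_none /=.
have := bE d; rewrite /= PE // => /eqP; rewrite subr_eq => /eqP ->.
rewrite (eq_bigr (fun i => mu i * a' i d - (ak d / ak d0) * (mu i * a' i d0))).
  rewrite sumrB -mulr_sumr.
  under [in RHS]eq_bigr => i _ do rewrite liftK /= -/(a' i).
  rewrite /nu -/ak; ring.
by move=> i _; rewrite PE; [ring | exact: a_lin].
Qed.

(** * Derivatives along rays, and KKT conditions under a Mangasarian-Fromovitz condition *)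

Definition ray_derivative (R : realType) (V : lmodType R) (h : V -> R)
    (e d : V) (l : R) : Prop :=
  t^-1 * (h (t *: d + e) - h e) @[t --> 0^'+] --> l.

Lemma differentiable_ray_derivative (R : realType) (V : normedModType R)
    (h : V -> R) (e d : V) :
  differentiable h e -> ray_derivative h e d ('d h e d).
Proof.
move=> dh; rewrite -deriveE //; apply: cvg_dnbhs_at_right.
exact: (diff_derivable dh).
Qed.

(** The increment is [t] times a convergent quotient. This continuity along rays stands in for
    continuity on [V]. *)
Lemma ray_cvg (R : realType) (V : lmodType R) (h : V -> R) (e d : V) (l : R) :
  ray_derivative h e d l -> h (t *: d + e) @[t --> 0^'+] --> h e.
Proof.
move=> hl; have : t * (t^-1 * (h (t *: d + e) - h e)) + h e @[t --> (0 : R)^'+]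
    --> 0 * l + h e.
  apply: cvgD; last exact: cvg_cst.
  by apply: cvgM => //; apply: cvg_at_right_filter; exact: cvg_id.
rewrite mul0r add0r; apply: cvg_trans; apply: near_eq_cvg.
near=> t; rewrite mulrA divff ?mul1r ?subrK //.
Unshelve. all: by end_near. Qed.

(** For [0 < t <= 1], convexity on the segment bounds the difference quotient by the full increment,
    and the bound passes to the limit. *)
Lemma convex_ray_derivative_le (R : realType) (V : lmodType R) (h : V -> R)
    (e e' : V) (l : R) :
  convex_function [set: V] h -> ray_derivative h e (e' - e) l ->
  l <= h e' - h e.
Proof.
move=> h_conv hl; apply: (cvgr_to_le hl); near=> t.
have t0 : 0 < t by near: t; exact: nbhs_right_gt.
have t1 : t <= 1 by near: t; exact: nbhs_right_le.
have := h_conv (Itv01 (ltW t0) t1) e' e (in_setT _) (in_setT _).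
rewrite convRE /=.
rewrite [X in h X](_ : _ = t *: (e' - e) + e); last first.
  by rewrite /conv /= scalerBr /unstable.onem scalerBl scale1r addrA addrAC.
rewrite ler_pdivrMl // => ht; move: ht.
rewrite /unstable.onem; lra.
Unshelve. all: by end_near. Qed.

(** An active constraint is pushed down by the negative limit of its quotient; an inactive one stays
    negative by continuity along the ray. *)
Lemma ray_le0_near (R : realType) (V : lmodType R) (h : V -> R) (e d : V)
    (l : R) :
  ray_derivative h e d l -> h e <= 0 -> (h e = 0 -> l < 0) ->
  \forall t \near 0^'+, h (t *: d + e) <= 0.
Proof.
move=> hl; rewrite le_eqVlt => /predU1P[he0 /(_ he0) l0|he0 _].
  near=> t.
  have t0 : 0 < t by near: t; exact: nbhs_right_gt.
  have : t^-1 * (h (t *: d + e) - h e) <= 0 by near: t; exact: (cvgr_le _ hl).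
  by rewrite he0 subr0 pmulr_rle0 ?invr_gt0.
exact: (cvgr_le _ (ray_cvg hl)).
Unshelve. all: by end_near. Qed.

(* Only directional derivatives along rays enter, so [V] needs no topology. *)
Lemma mfcq_kkt (R : realType) (V : lmodType R) (k : nat) (h : V -> R)
    (c : 'I_k -> V -> R) (e : V) (dh : V -> R) (dc : 'I_k -> V -> R) :
    scalar dh -> (forall i, scalar (dc i)) ->
    (forall d, ray_derivative h e d (dh d)) ->
    (forall i d, ray_derivative (c i) e d (dc i d)) ->
    (forall i, c i e <= 0) ->
    (forall d, \forall t \near (0 : R)^'+,
      (forall i, c i (t *: d + e) <= 0) -> h e <= h (t *: d + e)) ->
    (exists d, forall i, c i e = 0 -> dc i d < 0) ->
  exists mu : 'I_k -> R, [/\ forall i, 0 <= mu i,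
    forall i, mu i * c i e = 0 &
    forall d, dh d + \sum_i mu i * dc i d = 0].
Proof.
move=> dh_lin dc_lin hd cd ce0 e_min [d0 d0P].
(* A direction that strictly decreases every active constraint stays feasible for small [t], so
   minimality of [e] makes the quotients of [h] nonnegative. *)
have strict d : (forall i, c i e = 0 -> dc i d < 0) -> 0 <= dh d.
  move=> dP; rewrite -oppr_le0; apply: (cvgr_to_le (cvgN (hd d))); near=> t.
  have t0 : 0 < t by near: t; exact: nbhs_right_gt.
  rewrite oppr_le0; apply: mulr_ge0; first by rewrite invr_ge0 ltW.
  rewrite subr_ge0.
  have : forall i, c i (t *: d + e) <= 0.
    near: t; apply: filter_forall => i.
    exact: ray_le0_near (cd i d) (ce0 i) (dP i).
  by near: t; exact: e_min.
(* Adding [s *: d0] with [0 < s] makes the decrease strict; a small [s] then suffices. *)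
have weak d : (forall i, c i e = 0 -> dc i d <= 0) -> 0 <= dh d.
  move=> dP.
  have eps s : 0 < s -> 0 <= s * dh d0 + dh d.
    move=> s0; rewrite -dh_lin; apply: strict => i ci0; rewrite dc_lin.
    by apply: ltr_nwDl; [rewrite pmulr_rlt0 ?d0P | exact: dP].
  rewrite leNgt; apply/negP => dhd.
  have dhd0 : 0 < dh d0 by have := eps 1 ltr01; lra.
  (* With this [s] the perturbed inequality reads [0 <= dh d / 2], against [dh d < 0]. *)
  have /eps : 0 < - dh d / (2 * dh d0) by rewrite divr_gt0 ?mulr_gt0 ?oppr_gt0.
  rewrite (_ : - dh d / (2 * dh d0) * dh d0 = - dh d / 2); first by lra.
  by field; rewrite gt_eqF.
(* Zero functionals replace the inactive constraints, so the premise of [farkas] restricts only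
   active ones. The multipliers of inactive constraints are reset to [0] below, which gives
   complementarity. *)
pose a i d := if c i e == 0 then dc i d else 0.
have [||d Hd|mu mu0 dhE] := @farkas R V k a (fun d => - dh d).
- by move=> i s u v; rewrite /a; case: ifP => _; rewrite ?dc_lin // mulr0 addr0.
- by move=> s u v /=; rewrite dh_lin; ring.
- rewrite oppr_le0; apply: weak => i ci0.
  by have := Hd i; rewrite /a ci0 eqxx.
exists (fun i => if c i e == 0 then mu i else 0); split=> [i|i|d].
- by case: ifP.
- by case: eqP => [->|_]; rewrite ?mulr0 ?mul0r.
- apply/eqP; rewrite addrC addr_eq0 dhE; apply/eqP; apply: eq_bigr => i _.
  by rewrite /a; case: ifP => _; rewrite ?mulr0 ?mul0r.
Unshelve. all: by end_near. Qed.

(** * Linear functionals, differentials and partial gradients in coordinates *)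

Lemma scalarDZ (R : comPzRingType) (V : lmodType R) (h1 h2 : V -> R) (a : R) :
  scalar h1 -> scalar h2 -> scalar (fun d => h1 d + a * h2 d).
Proof. by move=> h1_lin h2_lin s u v; rewrite h1_lin h2_lin; ring. Qed.

Lemma ray_derivativeDZ (R : realType) (V : lmodType R) (h1 h2 : V -> R)
    (a : R) (e d : V) (l1 l2 : R) :
  ray_derivative h1 e d l1 -> ray_derivative h2 e d l2 ->
  ray_derivative (fun e => h1 e + a * h2 e) e d (l1 + a * l2).
Proof.
move=> h1l h2l; rewrite /ray_derivative [X in X @ _](_ : _ =
  (fun t => t^-1 * (h1 (t *: d + e) - h1 e)) \+
  (fun t => a * (t^-1 * (h2 (t *: d + e) - h2 e)))); last first.
  by apply/funext => t /=; ring.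
exact: (cvgD h1l (cvgM (cvg_cst a) h2l)).
Qed.

Lemma scalar_ray_derivative (R : realType) (V : lmodType R) (h : V -> R)
    (e d : V) :
  scalar h -> ray_derivative h e d (h d).
Proof.
move=> h_lin; rewrite /ray_derivative; apply: cvg_near_cst; near=> t.
have t0 : 0 < t by near: t; exact: nbhs_right_gt.
by rewrite h_lin addrK mulrA mulVf ?mul1r // gt_eqF.
Unshelve. all: by end_near. Qed.

(** Used to pass from differentials, which are linear functionals, to the vectors [grad1] and
    [grad2]. *)
Lemma scalar_dot (R : realType) (k : nat) (phi : 'rV[R]_k -> R) (a : 'rV[R]_k) :
  scalar phi -> phi a = dot (\row_i phi (delta_mx 0 i)) a.
Proof.
move=> phi_lin.
have phi0 : phi 0 = 0 by have := phi_lin 1 0 0; rewrite scaler0 addr0; lra.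
have phiD : {morph phi : u v / u + v}.
  by move=> u v; rewrite -[u in LHS]scale1r phi_lin mul1r.
rewrite {1}[a]row_sum_delta (big_morph phi phiD phi0); apply: eq_bigr => i _.
by rewrite -[_ *: _]addr0 phi_lin phi0 addr0 mxE mulrC.
Qed.

Lemma dot_delta (R : realType) (k : nat) (a : 'rV[R]_k) (i : 'I_k) :
  dot a (delta_mx 0 i) = a 0 i.
Proof.
rewrite /dot (bigD1 i) //= mxE !eqxx mulr1 big1 ?addr0 // => j /negPf ji.
by rewrite mxE ji andbF mulr0.
Qed.

Section gradients.
Context {R : realType} {n m : nat}.
Implicit Types (h : 'rV[R]_n * 'rV[R]_m -> R) (e : 'rV[R]_n * 'rV[R]_m).

Lemma diff_prod_split h e a b :
  'd h e (a, b) = 'd h e (a, 0) + 'd h e (0, b).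
Proof.
rewrite -linearD; congr ('d h e _).
by rewrite [RHS]surjective_pairing /= addr0 add0r.
Qed.

Lemma diff_scalar h e : scalar ('d h e).
Proof. by move=> s u v; exact: linearP. Qed.

Lemma diff_scalar1 h e : scalar (fun a => 'd h e (a, 0)).
Proof.
move=> s u v; rewrite -linearP; congr ('d h e _).
by rewrite [RHS]surjective_pairing /= scaler0 addr0.
Qed.

Lemma diff_scalar2 h e : scalar (fun b => 'd h e (0, b)).
Proof.
move=> s u v; rewrite -linearP; congr ('d h e _).
by rewrite [RHS]surjective_pairing /= scaler0 addr0.
Qed.

Lemma grad1E h e i : differentiable h e ->
  grad1 h e 0 i = 'd h e (delta_mx 0 i, 0).
Proof. by move=> dh; rewrite mxE deriveE. Qed.

Lemma grad2E h e i : differentiable h e ->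
  grad2 h e 0 i = 'd h e (0, delta_mx 0 i).
Proof. by move=> dh; rewrite mxE deriveE. Qed.

Lemma diff_grad1 h e a : differentiable h e ->
  'd h e (a, 0) = dot (grad1 h e) a.
Proof.
move=> dh; rewrite (scalar_dot a (@diff_scalar1 h e)); congr dot.
by apply/rowP => i; rewrite mxE grad1E.
Qed.

Lemma diff_grad2 h e b : differentiable h e ->
  'd h e (0, b) = dot (grad2 h e) b.
Proof.
move=> dh; rewrite (scalar_dot b (@diff_scalar2 h e)); congr dot.
by apply/rowP => i; rewrite mxE grad2E.
Qed.

Lemma diff_grad h e (d : 'rV[R]_(n + m)) : differentiable h e ->
  'd h e (lsubmx d, rsubmx d) = dot (grad h e) d.
Proof.
move=> dh; rewrite diff_prod_split diff_grad1 // diff_grad2 // /dot /grad.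
rewrite big_split_ord.
by congr (_ + _); apply: eq_bigr => i _; rewrite ?row_mxEl ?row_mxEr !mxE.
Qed.

Lemma ray_derivative2 h x y d : differentiable h (x, y) ->
  ray_derivative (fun z => h (x, z)) y d ('d h (x, y) (0, d)).
Proof.
move=> /differentiable_ray_derivative - /(_ (0, d)).
rewrite /ray_derivative; apply: cvg_trans.
apply: near_eq_cvg; near=> t.
have -> : t *: (0, d) + (x, y) = (x, t *: d + y).
  by rewrite [LHS]surjective_pairing /= scaler0 add0r.
by [].

Unshelve. all: by end_near. Qed.

Lemma differentiable_component (V : normedModType R) k (h : V -> 'rV[R]_k)
    (e : V) i :
  differentiable h e -> differentiable (component h i) e.
Proof.
move=> dh; apply: (@differentiable_comp _ _ _ _ h (fun N : 'rV[R]_k => N 0 i)).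
  exact: dh.
exact: differentiable_coord.
Qed.

Lemma derive_lagrangian q (f : 'rV[R]_n * 'rV[R]_m -> R)
    (g : 'rV[R]_n * 'rV[R]_m -> 'rV[R]_q) (w : 'rV[R]_q) e d :
  differentiable f e -> differentiable g e ->
  'D_d (lagrangian f g w) e =
  'd f e d + \sum_j w 0 j * 'd (component g j) e d.
Proof.
move=> df dg.
have -> : lagrangian f g w = f + \sum_j (w 0 j \*: component g j).
  apply/funext => e'; rewrite /lagrangian fctE; congr (_ + _).
  by rewrite fct_sumE.
have dgj j : derivable (component g j) e d.
  exact/diff_derivable/differentiable_component.
rewrite deriveD; [|exact: diff_derivable|]; last first.
  by apply: derivable_sum => j; apply: derivableZ.
rewrite deriveE // derive_sum => [|j]; last exact: derivableZ.
congr (_ + _); apply: eq_bigr => j _; rewrite deriveZ // deriveE //.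
exact: differentiable_component.
Qed.

End gradients.

(** * The value function: a subgradient, and the penalty from partial calmness *)

Lemma lower_value_eq (R : realType) (n m q : nat)
    (f : 'rV[R]_n * 'rV[R]_m -> R) (g : 'rV[R]_n * 'rV[R]_m -> 'rV[R]_q)
    (x : 'rV[R]_n) (z : 'rV[R]_m) :
  lower_sol f g x z -> lower_value f g x = f (x, z).
Proof.
move=> [z_feas z_min]; apply/eqP; rewrite eq_le; apply/andP; split.
  apply: ge_inf; last by exists z.
  by exists (f (x, z)) => _ [z' z'_feas <-]; exact: z_min.
apply: lb_le_inf; first by exists (f (x, z)), z.
by move=> _ [z' z'_feas <-]; exact: z_min.
Qed.

(** For [z] solving the lower-level problem at [x'], add the gradient inequalities at [(x, y)] of
    [f] and, weighted by [w], of the constraints. Stationarity cancels the terms in [z - y], and the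
    weighted constraint increments are nonpositive. *)
Lemma lower_value_subgradient (R : realType) (n m q : nat)
    (f : 'rV[R]_n * 'rV[R]_m -> R) (g : 'rV[R]_n * 'rV[R]_m -> 'rV[R]_q)
    (x : 'rV[R]_n) (y : 'rV[R]_m) :
    (forall x', lower_sol f g x' !=set0) ->
    differentiable f (x, y) -> differentiable g (x, y) ->
    fully_convex f -> (forall j, fully_convex (component g j)) ->
    lower_sol f g x y ->
    (exists d, forall j, g (x, y) 0 j = 0 ->
      dot (grad2 (component g j) (x, y)) d < 0) ->
  exists w : 'rV[R]_q, [/\ vle 0 w, dot w (g (x, y)) = 0,
    grad2 f (x, y) + \sum_j w 0 j *: grad2 (component g j) (x, y) = 0 &
    forall x', f (x, y) + dot (grad1 (lagrangian f g w) (x, y)) (x' - x)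
      <= lower_value f g x'].
Proof.
move=> S_neq0 df dg f_conv g_conv [y_feas y_min] [d0 d0P].
have dgj j : differentiable (component g j) (x, y).
  exact: differentiable_component.
(* KKT conditions for the lower-level problem with [x] frozen. *)
have [||d|j d|j|d||w [w0 w_compl w_stat]] := @mfcq_kkt R 'rV[R]_m q
    (fun z => f (x, z)) (fun j z => component g j (x, z)) y
    (fun d => 'd f (x, y) (0, d)) (fun j d => 'd (component g j) (x, y) (0, d)).
- exact: diff_scalar2.
- by move=> j; exact: diff_scalar2.
- exact: ray_derivative2.
- exact: ray_derivative2.
- by have := y_feas j; rewrite mxE.
- near=> t => z_feas; apply: y_min => j; rewrite mxE; exact: z_feas.
- by exists d0 => j gj0; rewrite diff_grad2 // d0P.
exists (\row_j w j); split.
- by move=> j; rewrite !mxE.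
- by rewrite /dot big1 // => j _; rewrite mxE w_compl.
- apply/rowP => i; rewrite !mxE summxE deriveE //.
  rewrite -[RHS](w_stat (delta_mx 0 i)); congr (_ + _); apply: eq_bigr => j _.
  by rewrite !mxE deriveE.
move=> x'; have [z [z_feas z_min]] := S_neq0 x'.
rewrite (lower_value_eq (conj z_feas z_min)).
have -> : dot (grad1 (lagrangian f g (\row_j w j)) (x, y)) (x' - x) =
    'd f (x, y) (x' - x, 0) +
    \sum_j w j * 'd (component g j) (x, y) (x' - x, 0).
  rewrite diff_grad1 // /dot; under eq_bigr => i _.
    rewrite mxE derive_lagrangian // mulrDl mulr_suml.
    under [X in _ + X]eq_bigr => j _ do rewrite mxE -mulrA.
    over.
  rewrite big_split /= exchange_big /=; congr (_ + _).
    by apply: eq_bigr => i _; rewrite [grad1 _ _ _ _]mxE deriveE.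
  apply: eq_bigr => j _; rewrite -mulr_sumr diff_grad1 //; congr (_ * _).
  by apply: eq_bigr => i _; rewrite [grad1 _ _ _ _]mxE deriveE.
have E : (x', z) - (x, y) = (x' - x, z - y) by [].
have grad_le (h : 'rV[R]_n * 'rV[R]_m -> R) :
    fully_convex h -> differentiable h (x, y) ->
    'd h (x, y) (x' - x, 0) + 'd h (x, y) (0, z - y) <= h (x', z) - h (x, y).
  move=> h_conv dh; rewrite -diff_prod_split -E.
  apply: (convex_ray_derivative_le h_conv).
  exact: differentiable_ray_derivative.
have := grad_le f f_conv df; have := w_stat (z - y).
(* Complementarity removes the values at [(x, y)]; those at [(x', z)] are nonpositive by feasibility
   of [z]. *)
have : \sum_j w j * ('d (component g j) (x, y) (x' - x, 0) +
    'd (component g j) (x, y) (0, z - y)) <= 0.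
  apply: sumr_le0 => j _.
  apply: (le_trans (ler_wpM2l (w0 j) (grad_le _ (g_conv j) (dgj j)))).
  rewrite mulrBr w_compl subr0 mulr_ge0_le0 //.
  by have := z_feas j; rewrite mxE.
under eq_bigr => j _ do rewrite mulrDr.
rewrite big_split /=; lra.
Unshelve. all: by end_near. Qed.

(* The subgradient inequality squeezes the slack [lower_value - f] to [0] along
   feasible points of a ray: continuity of the value function is not needed. *)
Lemma partial_calm_min (R : realType) (n m p q : nat)
    (F f : 'rV[R]_n * 'rV[R]_m -> R) (G : 'rV[R]_n * 'rV[R]_m -> 'rV[R]_p)
    (g : 'rV[R]_n * 'rV[R]_m -> 'rV[R]_q) (x : 'rV[R]_n) (y : 'rV[R]_m)
    (xi : 'rV[R]_n -> R) :
    (forall x', lower_sol f g x' !=set0) ->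
    differentiable f (x, y) -> scalar xi ->
    (forall x', f (x, y) + xi (x' - x) <= lower_value f g x') ->
    VF_partially_calm F f G g (x, y) ->
  exists2 lambda : R, 0 < lambda &
    let h e := F e + lambda * (f e + -1 * xi e.1) in
    forall d, \forall t \near 0^'+,
      vle (G (t *: d + (x, y))) 0 -> vle (g (t *: d + (x, y))) 0 ->
      h (x, y) <= h (t *: d + (x, y)).
Proof.
move=> S_neq0 df xi_lin xi_sub [lambda lambda0 [U [[A B] /= [nA nB] AB] calm]].
exists lambda => // d.
have xiB u v : xi (u - v) = xi u - xi v.
  by rewrite addrC -scaleN1r xi_lin mulN1r addrC.
have [eps eps0 epsB] := (nbhs_ballP _ _).1 nB.
(* [k e - k (x, y)] is the gap between [f] and the affine minorant at [e]; it dominates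
   [f e - lower_value f g e.1]. *)
pose k (e : 'rV[R]_n * 'rV[R]_m) := f e + -1 * xi e.1.
have kl : ray_derivative k (x, y) d ('d f (x, y) d + -1 * xi d.1).
  apply: ray_derivativeDZ; first exact: differentiable_ray_derivative.
  apply: (@scalar_ray_derivative _ _ (fun e : 'rV[R]_n * 'rV[R]_m => xi e.1)).
  by move=> s u v; exact: xi_lin.
have k_cvg := ray_cvg kl.
have e_cvg : t *: d + (x, y) @[t --> (0 : R)^'+] --> (x, y).
  rewrite -[X in _ --> X]add0r -(scale0r d); apply: cvgD; last exact: cvg_cst.
  by apply: cvgZr_tmp; apply: cvg_at_right_filter; exact: cvg_id.
near=> t.
have Ae : A (t *: d + (x, y)) by near: t; exact: e_cvg.
have ke : k (t *: d + (x, y)) < k (x, y) + eps.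
  by near: t; apply: (cvgr_lt _ k_cvg); rewrite ltrDl.
set e := t *: d + (x, y) in Ae ke * => Gt gt.
have [z zS] := S_neq0 e.1; have vE := lower_value_eq zS.
have fz : f (e.1, z) <= f e.
  case: zS => _; rewrite [in leRHS](surjective_pairing e).
  by apply; case: (e) gt.
have := xi_sub e.1; rewrite xiB -vE in fz * => fsub.
have s_small : `|lower_value f g e.1 - f e| < eps.
  rewrite ler0_norm ?subr_le0 //; move: ke; rewrite /k /=; lra.
have Ue : U (e, lower_value f g e.1 - f e).
  by apply: AB; split => //=; apply: epsB; rewrite /ball /= sub0r normrN.
(* The slack [lower_value f g e.1 - f e] is exactly the perturbation that the constraint in partial
   calmness requires at [e]. *)
have := calm _ _ Ue Gt gt; rewrite addrC addrA subrK subrr => /(_ erefl).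
rewrite ler0_norm ?subr_le0 // /= => calm_e.
(* As [0 < lambda], the value-function gap may be replaced by the larger gap to the minorant, which
   is the penalty in [h]. *)
have : 0 <= lambda * (f e - xi e.1 - (f (x, y) - xi x) -
    (f e - lower_value f g e.1)).
  by rewrite pmulr_rge0 //; lra.
lra.
Unshelve. all: by end_near. Qed.

(** * Multipliers of the penalized single-level problem *)

Theorem theorem3p2 (R : realType) (n m p q : nat)
  (F f : 'rV[R]_n * 'rV[R]_m -> R)
  (G : 'rV[R]_n * 'rV[R]_m -> 'rV[R]_p)
  (g : 'rV[R]_n * 'rV[R]_m -> 'rV[R]_q)
  (x : 'rV[R]_n) (y : 'rV[R]_m)
  (F_C2 : C2 F) (f_C2 : C2 f) (G_C2 : C2 G) (g_C2 : C2 g)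
  (S_neq0 : forall x', lower_sol f g x' !=set0)
  (xy_opt : VF_local_solution F f G g (x, y))
  (xy_calm : VF_partially_calm F f G g (x, y))
  (f_convex : fully_convex f)
  (g_convex : forall j, fully_convex (component g j))
  (x_LMFCQ : LMFCQ f g x)
  (xy_UMFCQ : UMFCQ G g (x, y)) :
  exists (lambda : R) (u : 'rV[R]_p) (v w : 'rV[R]_q) (z : 'rV[R]_m),
    0 < lambda /\
    grad1 F (x, y) + \sum_(i < p) u 0 i *: grad1 (component G i) (x, y)
      + \sum_(j < q) v 0 j *: grad1 (component g j) (x, y)
      + lambda *: grad1 f (x, y)
      - lambda *: grad1 (lagrangian f g w) (x, z) = 0 /\
    grad2 F (x, y) + \sum_(i < p) u 0 i *: grad2 (component G i) (x, y)
      + \sum_(j < q) v 0 j *: grad2 (component g j) (x, y)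
      + lambda *: grad2 f (x, y) = 0 /\
    grad2 f (x, z) + \sum_(j < q) w 0 j *: grad2 (component g j) (x, z) = 0 /\
    (vle 0 u /\ vle (G (x, y)) 0 /\ dot u (G (x, y)) = 0) /\
    (vle 0 v /\ vle (g (x, y)) 0 /\ dot v (g (x, y)) = 0) /\
    (vle 0 w /\ vle (g (x, z)) 0 /\ dot w (g (x, z)) = 0).
Proof.
have dF := F_C2.1 (x, y); have df := f_C2.1 (x, y).
have dG := G_C2.1 (x, y); have dg := g_C2.1 (x, y).
have dGi i : differentiable (component G i) (x, y).
  exact: differentiable_component.
have dgj j : differentiable (component g j) (x, y).
  exact: differentiable_component.
have [[G_feas g_feas f_le] _] := xy_opt.
have yS : lower_sol f g x y.
  split=> // z' z'_feas; have [z [z_feas z_min]] := S_neq0 x.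
  apply: le_trans (z_min _ z'_feas).
  by rewrite -(lower_value_eq (conj z_feas z_min)).
have [w [w0 w_compl w_stat w_sub]] :=
  lower_value_subgradient S_neq0 df dg f_convex g_convex yS (x_LMFCQ y yS).
pose xi (a : 'rV[R]_n) := dot (grad1 (lagrangian f g w) (x, y)) a.
have xi_lin : scalar xi.
  move=> s u v; rewrite /xi /dot mulr_sumr -big_split /=.
  by apply: eq_bigr => i _; rewrite !mxE; ring.
(* In lower-level directions [(0, b)] the minorant is constant, hence no Lagrangian term in the
   second equation. *)
have xi0 : xi 0 = 0 by have := xi_lin 1 0 0; rewrite scaler0 addr0; lra.
have [lambda lambda0 h_min] :=
  partial_calm_min S_neq0 df xi_lin w_sub xy_calm.
(* Both constraint blocks form one family, so a single application of [mfcq_kkt] gives [mu], whose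
   two halves are [u] and [v]. *)
pose c (i : 'I_(p + q)) := match fintype.split i with
  inl i => component G i | inr j => component g j end.
have dc i : differentiable (c i) (x, y) by rewrite /c; case: fintype.split.
have [||d|i d|i|d||mu [mu0 mu_compl mu_stat]] := @mfcq_kkt R _ (p + q)
    (fun e => F e + lambda * (f e + -1 * xi e.1)) c (x, y)
    (fun d => 'd F (x, y) d + lambda * ('d f (x, y) d + -1 * xi d.1))
    (fun i => 'd (c i) (x, y)).
- apply: scalarDZ; first exact: diff_scalar.
  apply: scalarDZ; first exact: diff_scalar.
  by move=> s u v; exact: xi_lin.
- by move=> i; exact: diff_scalar.
- apply: ray_derivativeDZ; first exact: differentiable_ray_derivative.
  apply: ray_derivativeDZ; first exact: differentiable_ray_derivative.
  apply: (@scalar_ray_derivative _ _ (fun e : 'rV[R]_n * 'rV[R]_m => xi e.1)).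
  by move=> s u v; exact: xi_lin.
- exact: differentiable_ray_derivative.
- rewrite /c; case: fintype.split => j.
    by have := G_feas j; rewrite mxE.
  by have := g_feas j; rewrite mxE.
- have := h_min d; apply: filterS => t h_le c_le; apply: h_le => j.
    by have := c_le (lshift q j); rewrite /c (unsplitK (inl j)) mxE.
  by have := c_le (rshift p j); rewrite /c (unsplitK (inr j)) mxE.
- have [d [dG0 dg0]] := xy_UMFCQ; exists (lsubmx d, rsubmx d) => i.
  rewrite diff_grad // /c; case: fintype.split => j; [exact: dG0|exact: dg0].
have mu_eq d : 'd F (x, y) d + lambda * ('d f (x, y) d - xi d.1) +
    (\sum_i mu (lshift q i) * 'd (component G i) (x, y) d +
     \sum_j mu (rshift p j) * 'd (component g j) (x, y) d) = 0.
  have cl i : c (lshift q i) = component G i by rewrite /c (unsplitK (inl i)).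
  have cr j : c (rshift p j) = component g j by rewrite /c (unsplitK (inr j)).
  have := mu_stat d; rewrite big_split_ord /=.
  under eq_bigr => i _ do rewrite cl.
  under [X in _ + (_ + X)]eq_bigr => j _ do rewrite cr.
  by rewrite mulN1r.
have rowD k (a b : 'rV[R]_k) i : (a + b) 0 i = a 0 i + b 0 i by rewrite mxE.
have rowN k (a : 'rV[R]_k) i : (- a) 0 i = - a 0 i by rewrite mxE.
have rowZ k s (a : 'rV[R]_k) i : (s *: a) 0 i = s * a 0 i by rewrite mxE.
have alg1 (a b l s1 s2 : R) : a + s1 + s2 + lambda * b - lambda * l =
  a + lambda * (b - l) + (s1 + s2) by ring.
(* The [0] is the value of [xi] left by [xi0]. *)
have alg2 (a b s1 s2 : R) : a + s1 + s2 + lambda * b =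
  a + lambda * (b - 0) + (s1 + s2) by ring.
exists lambda, (\row_i mu (lshift q i)), (\row_j mu (rshift p j)), w, y.
split=> //; split; last split; last split; last split; last split.
- apply/rowP => i; have := mu_eq (delta_mx 0 i, 0); rewrite /= /xi dot_delta.
  rewrite !(rowD, rowN, rowZ) !summxE (grad1E i dF) (grad1E i df).
  under [in X in _ -> X]eq_bigr => k _ do rewrite rowZ mxE grad1E //.
  under [X in _ -> _ + X + _ - _ = _]eq_bigr => k _
    do rewrite rowZ mxE grad1E //.
  by move=> E; rewrite [RHS]mxE -[RHS]E; exact: alg1.
- apply/rowP => i; have := mu_eq (0, delta_mx 0 i); rewrite /= xi0.
  rewrite !(rowD, rowN, rowZ) !summxE (grad2E i dF) (grad2E i df).
  under [in X in _ -> X]eq_bigr => k _ do rewrite rowZ mxE grad2E //.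
  under [X in _ -> _ + X + _ = _]eq_bigr => k _ do rewrite rowZ mxE grad2E //.
  by move=> E; rewrite [RHS]mxE -[RHS]E; exact: alg2.
- exact: w_stat.
- split; [by move=> i; rewrite !mxE|split=> //].
  rewrite /dot big1 // => i _; rewrite mxE.
  by have := mu_compl (lshift q i); rewrite /c (unsplitK (inl i)).
- split; [by move=> i; rewrite !mxE|split=> //].
  rewrite /dot big1 // => i _; rewrite mxE.
  by have := mu_compl (rshift p i); rewrite /c (unsplitK (inr i)).
- by split=> //; split.
Qed.
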